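(* Let $\nabla:\Omega^1_{D_\phi}(\mathcal A_{\mathbb Z_2})\to T^2_{D_\phi}(\mathcal A_{\mathbb Z_2})$ be the left connection determined by $\nabla\eta=c\,(\eta\otimes\eta)$ with $c=\mathrm{diag}(1,-1)\in\mathcal A_{\mathbb Z_2}$. Then the torsion functionals $\mathscr T^\nabla_{\sigma_2}$ and $\mathscr T_\Psi$ of $\nabla$ are equal and both agree with the spectral torsion functional $\mathscr T_{D_\phi}$; that is, for all $u,v,w\in\Omega^1_{D_\phi}(\mathcal A_{\mathbb Z_2})$, $$\mathscr T^\nabla_{\sigma_2}(u,v,w)=\mathscr T_\Psi(u,v,w)=\mathrm{Tr}(u\,v\,w\,D_\phi)=\mathscr T_{D_\phi}(u,v,w).$$
   Context: Let $\mathfrak h=\mathfrak h_+\oplus\mathfrak h_-$ with $\mathfrak h_\pm$ finite-dimensional Hilbert spaces (possibly of different dimensions), $\phi:\mathfrak h_-\to\mathfrak h_+$ a nonzero linear map with adjoint $\phi^*$, and $D_\phi=\begin{bmatrix}0&\phi\\ \phi^*&0\end{bmatrix}$. The algebra $\mathcal A_{\mathbb Z_2}=\mathbb C\oplus\mathbb C$ acts on $\mathfrak h$ by $(f_+,f_-)\mapsto \mathrm{diag}(f_+,f_-)$, where $f_\pm$ denotes $f_\pm$ times the identity of $\mathfrak h_\pm$. Put $e_+=\mathrm{diag}(1,0)$ and $\eta=[D_\phi,e_+]=\begin{bmatrix}0&-\phi\\ \phi^*&0\end{bmatrix}$. $\Omega^1_{D_\phi}(\mathcal A_{\mathbb Z_2})\subset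 B(\mathfrak h)$ is the linear span of the operators $a[D_\phi,b]$, $a,b\in\mathcal A_{\mathbb Z_2}$; it is the free left module of rank one generated by $\eta$. $T^2_{D_\phi}(\mathcal A_{\mathbb Z_2})=\Omega^1_{D_\phi}(\mathcal A_{\mathbb Z_2})\otimes_{\mathcal A_{\mathbb Z_2}}\Omega^1_{D_\phi}(\mathcal A_{\mathbb Z_2})$ is free of rank one, generated by $\eta\otimes\eta$, and $m:T^2_{D_\phi}(\mathcal A_{\mathbb Z_2})\to B(\mathfrak h)$ is multiplication of operators. A left connection is a $\mathbb C$-linear map $\nabla:\Omega^1_{D_\phi}\to T^2_{D_\phi}$ with $\nabla(aw)=a\nabla w+[D_\phi,a]\otimes w$. In this example there are no nonzero junk forms or junk tensors in degree two, so in Connes' calculus the junk projection $\sigma_2$ is the identity, and in the Mesland–Rennie calculus the idempotent $\Psi$ is necessarily $0$. Accordingly the torsions of $\nabla$ are $T^\nabla_{\sigma_2}=m\circ\nabla-\mathrm d_{\sigma_2}$, where $\mathrm d_{\sigma_2}(a[D_\phi,b])=[D_\phi,a][D_\phi,b]$, and $T^\nabla_\Psi=\nabla-\mathrm d_\Psi$, where $\mathrm d_\Psi(a[D_\phi,b])=[D_\phi,a]\otimes[D_\phi,b]$ (both differentials extended linearly; they are well defined). The trilinear functionals, for $u,v,w\in\Omega^1_{D_\phi}(\mathcal A_{\mathbb Z_2})$, are $\mathscr T^\nabla_{\sigma_2}(u,v,w)=\mathrm{Tr}(u\,v\,T^\nabla_{\sigma_2}(w))$, $\mathscr T_\Psi(u,v,w)=\mathrm{Tr}(u\,v\,m(T^\nabla_\Psi(w)))$,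 and the spectral torsion functional is $\mathscr T_{D_\phi}(u,v,w)=\mathrm{Tr}(u\,v\,w\,D_\phi)$, with $\mathrm{Tr}$ the matrix trace. *)

(* Defs.v *)
From HB Require Import structures.
From mathcomp Require Import all_boot all_order all_algebra.
From mathcomp Require Import boolp reals complex freeg.

Set Implicit Arguments.
Unset Strict Implicit.
Unset Printing Implicit Defensive.

Import Order.TTheory GRing.Theory Num.Theory.
Local Open Scope ring_scope.
Local Open Scope quotient_scope.

Section LinearSpan.
Variables (K : fieldType) (V : lmodType K).

Definition lspan (P : V -> Prop) : {pred V} := fun x =>
  `[< exists s : seq (K * V),
        (forall p, p \in s -> P p.2) /\ x = \sum_(p <- s) p.1 *: p.2 >].

Variable P : V -> Prop.

Lemma lspan_gen x : P x -> x \in lspan P.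
Proof.
move=> Px; apply/asboolP; exists [:: (1, x)].
by split=> [p|]; rewrite ?big_seq1 ?scale1r // inE => /eqP->.
Qed.

Lemma lspan_closed : submod_closed (lspan P).
Proof.
split; first by apply/asboolP; exists [::]; rewrite big_nil.
move=> k x y /asboolP [s [Ps ->]] /asboolP [t [Pt ->]]; apply/asboolP.
exists ([seq (k * p.1, p.2) | p <- s] ++ t); split.
  by move=> p; rewrite mem_cat => /orP [/mapP [q /Ps ? ->] //|/Pt].
rewrite big_cat big_map scaler_sumr /=; congr (_ + _).
by apply: eq_bigr => p _; rewrite scalerA.
Qed.

HB.instance Definition _ := GRing.isSubmodClosed.Build K V (lspan P) lspan_closed.
End LinearSpan.

Section FreeLift.
Variables (K : fieldType) (T : choiceType) (P : lmodType K) (f : T -> P).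

Lemma fglift_is_linear : linear (fglift f : {freeg T / K} -> P).
Proof.
have subf := @lift_is_additive K T P f.
have f0 : fglift f (0 : {freeg T / K}) = 0 by rewrite -(subrr 0) subf subrr.
have addf (D E : {freeg T / K}) : fglift f (D + E) = fglift f D + fglift f E.
  by rewrite -[E in LHS]opprK subf -[- E]add0r subf f0 sub0r opprK.
move=> k D E; rewrite addf; congr (_ + _); rewrite -[D in RHS]freeg_sumE.
rewrite [k *: D]/(fgscale k D) /fgscale !(big_morph _ addf f0) scaler_sumr.
by apply: eq_bigr => x _; rewrite !liftU scalerA.
Qed.

HB.instance Definition _ := GRing.isLinear.Build K {freeg T / K} P _ (fglift f)
  fglift_is_linear.
End FreeLift.

(* M (x)_A N for a K-algebra A acting on M from the right and on N from the
   left: the free K-module on M * N modulo the span of the relations below.   *)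
Section Tensor.
Variables (K : fieldType) (A : Type) (M N : lmodType K).
Variables (ract : M -> A -> M) (lact : A -> N -> N).

Definition fgpair (u : M) (v : N) : {freeg (M * N)%type / K} := << (u, v) >>.

Inductive tensor_relator : {freeg (M * N)%type / K} -> Prop :=
| relator_addl u u' v :
    tensor_relator (fgpair (u + u') v - (fgpair u v + fgpair u' v))
| relator_addr u v v' :
    tensor_relator (fgpair u (v + v') - (fgpair u v + fgpair u v'))
| relator_scalel k u v :
    tensor_relator (fgpair (k *: u) v - k *: fgpair u v)
| relator_scaler k u v :
    tensor_relator (fgpair u (k *: v) - k *: fgpair u v)
| relator_balanced u a v :
    tensor_relator (fgpair (ract u a) v - fgpair u (lact a v)).

Definition tensor_null : {pred {freeg (M * N)%type / K}} := lspan tensor_relator.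
HB.instance Definition _ := GRing.SubmodClosed.on tensor_null.

Definition tensor : Type := {ideal_quot tensor_null}.
HB.instance Definition _ := GRing.Zmodule.on tensor.
HB.instance Definition _ := Quotient.on tensor.

Local Notation tpi := (\pi_tensor : {freeg (M * N)%type / K} -> tensor).

Lemma tpiP x y : tpi x = tpi y <-> x - y \in tensor_null.
Proof.
split => [E|]; first by rewrite Quotient.idealrBE; apply/eqP.
by rewrite Quotient.idealrBE => /eqP E; exact: E.
Qed.

Lemma tensorW (P : tensor -> Prop) : (forall x, P (tpi x)) -> forall t, P t.
Proof. by move=> HP t; rewrite -(reprK t). Qed.

Lemma tpiD x y : tpi (x + y) = tpi x + tpi y.
Proof. exact: Quotient.pi_add. Qed.

Definition tensor_scale (k : K) (t : tensor) : tensor := tpi (k *: repr t).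

Lemma tpiZ k x : tpi (k *: x) = tensor_scale k (tpi x).
Proof.
apply/tpiP; rewrite -scalerBr; apply: rpredZ.
by apply/tpiP; rewrite reprK.
Qed.

Lemma tensor_scaleA j k t :
  tensor_scale j (tensor_scale k t) = tensor_scale (j * k) t.
Proof. by elim/tensorW: t => x; rewrite -!tpiZ scalerA. Qed.

Lemma tensor_scale1 : left_id 1 tensor_scale.
Proof. by elim/tensorW => x; rewrite -tpiZ scale1r. Qed.

Lemma tensor_scaleDr : right_distributive tensor_scale +%R.
Proof.
move=> k; elim/tensorW => x; elim/tensorW => y.
by rewrite -tpiD -!tpiZ scalerDr tpiD.
Qed.

Lemma tensor_scaleDl t : {morph tensor_scale^~ t : j k / j + k}.
Proof. by elim/tensorW: t => x j k; rewrite -!tpiZ scalerDl tpiD. Qed.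

HB.instance Definition _ := GRing.Zmodule_isLmodule.Build K tensor
  tensor_scaleA tensor_scale1 tensor_scaleDr tensor_scaleDl.

Lemma scale_tpi k x : tpi (k *: x) = k *: tpi x.
Proof. exact: tpiZ. Qed.

Definition tens (u : M) (v : N) : tensor := tpi (fgpair u v).

Lemma tensDl u u' v : tens (u + u') v = tens u v + tens u' v.
Proof. by rewrite -tpiD; apply/tpiP/lspan_gen; constructor. Qed.

Lemma tensDr u v v' : tens u (v + v') = tens u v + tens u v'.
Proof. by rewrite -tpiD; apply/tpiP/lspan_gen; constructor. Qed.

Lemma tensZl k u v : tens (k *: u) v = k *: tens u v.
Proof. by rewrite -scale_tpi; apply/tpiP/lspan_gen; constructor. Qed.

Lemma tensZr k u v : tens u (k *: v) = k *: tens u v.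
Proof. by rewrite -scale_tpi; apply/tpiP/lspan_gen; constructor. Qed.

Lemma tens_balanced u a v : tens (ract u a) v = tens u (lact a v).
Proof. by apply/tpiP/lspan_gen; constructor. Qed.

(* The map tens u v |-> f u v, extended linearly; meaningful for the f
   satisfying balanced_bilinear, see tensor_liftE and tensor_lift_linear.     *)
Definition tensor_lift (P : lmodType K) (f : M -> N -> P) (t : tensor) : P :=
  fglift (fun p => f p.1 p.2) (repr t).

Definition balanced_bilinear (P : lmodType K) (f : M -> N -> P) : Prop :=
  [/\ forall v, linear (f^~ v), forall u, linear (f u)
    & forall u a v, f (ract u a) v = f u (lact a v)].

Section Lift.
Variables (P : lmodType K) (f : M -> N -> P).
Hypothesis ff : balanced_bilinear f.

Local Notation g := (fglift (fun p : M * N => f p.1 p.2)).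

Lemma fglift_pair u v : g (fgpair u v) = f u v.
Proof. by rewrite /fgpair liftU scale1r. Qed.

Lemma fglift_relator x : tensor_relator x -> g x = 0.
Proof.
have [fl fr fb] := ff.
have f0v v : f 0 v = 0.
  by have /= := fl v (-1) 0 0; rewrite scaler0 addr0 scaleN1r addNr.
have fu0 u : f u 0 = 0.
  by have /= := fr u (-1) 0 0; rewrite scaler0 addr0 scaleN1r addNr.
case=> [u u' v|u v v'|k u v|k u v|u a v]; apply/eqP; rewrite linearB subr_eq0;
  apply/eqP; rewrite /= fglift_pair ?linearD ?linearZ /= !fglift_pair.
- by have /= := fl v 1 u u'; rewrite !scale1r.
- by have := fr u 1 v v'; rewrite !scale1r.
- by have /= := fl v k u 0; rewrite f0v !addr0.
- by have := fr u k v 0; rewrite fu0 !addr0.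
- exact: fb.
Qed.

Lemma fglift_null x : x \in tensor_null -> g x = 0.
Proof.
move=> /asboolP [s [relS ->]]; rewrite linear_sum big_seq.
by apply: big1 => p /relS /fglift_relator gp; rewrite linearZ /= gp scaler0.
Qed.

Lemma tensor_lift_pi x : tensor_lift f (tpi x) = g x.
Proof.
apply/eqP; rewrite -subr_eq0 -linearB; apply/eqP/fglift_null.
by apply/tpiP; rewrite reprK.
Qed.

Lemma tensor_liftE u v : tensor_lift f (tens u v) = f u v.
Proof. by rewrite tensor_lift_pi fglift_pair. Qed.

Lemma tensor_lift_linear : linear (tensor_lift f).
Proof.
move=> k; elim/tensorW => x; elim/tensorW => y; rewrite -scale_tpi -tpiD.
by rewrite !tensor_lift_pi linearP.
Qed.
End Lift.
End Tensor.

Section Trace.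
Variables (K : fieldType) (V : vectType K).

Definition lftrace (f : 'End(V)) : K :=
  \tr (passmx.mxof (vbasis fullv) (vbasis fullv) f).

Lemma lftrace_basis (e : (\dim {:V}).-tuple V) (f : 'End(V)) :
  basis_of {:V} e -> lftrace f = \tr (passmx.mxof e e f).
Proof.
move=> eb; have vb := vbasisP {:V}; rewrite /lftrace.
rewrite -[f in LHS]comp_lfun1r (@passmx.mxof_comp _ _ _ _ _ e) // mxtrace_mulC.
by rewrite -passmx.mxof_comp // comp_lfun1l.
Qed.
End Trace.

Section TwoPointSpace.
Variables (C : numClosedFieldType) (hp hm : vectType C).

Local Notation h := (hp * hm)%type.

Definition AZ2 : Type := (C^o * C^o)%type.
HB.instance Definition _ := GRing.Lalgebra.on AZ2.

Definition diag_act (a : AZ2) (x : h) : h := (a.1 *: x.1, a.2 *: x.2).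

Lemma diag_act_linear a : linear (diag_act a).
Proof.
move=> k x y; rewrite /diag_act /= !scalerDr !scalerA.
by rewrite ![_ * k]mulrC -!scalerA.
Qed.

Definition rep (a : AZ2) : 'End(h) := linfun (diag_act a).

Lemma repE a x : rep a x = (a.1 *: x.1, a.2 *: x.2).
Proof.
pose L := GRing.isLinear.Build _ _ _ _ _ (diag_act_linear a).
pose F : {linear h -> h} := HB.pack (diag_act a) L.
exact: (lfunE F x).
Qed.

Lemma rep_linear : linear rep.
Proof.
move=> k a b; apply/lfunP => x.
by rewrite add_lfunE scale_lfunE !repE /= !scalerDl -!scalerA.
Qed.

Lemma repM a b : rep (a * b) = (rep a \o rep b)%VF.
Proof. by apply/lfunP => x; rewrite comp_lfunE !repE /= !scalerA. Qed.

Lemma rep1 : rep 1 = \1%VF.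
Proof. by apply/lfunP => -[x y]; rewrite repE id_lfunE /= !scale1r. Qed.

Definition is_adjoint (dotp : {dot hp for Num.conj}) (dotm : {dot hm for Num.conj})
    (phi : 'Hom(hm, hp)) (phiS : 'Hom(hp, hm)) : Prop :=
  forall (x : hp) (y : hm), dotp (phi y) x = dotm y (phiS x).

Definition dirac_fun (phi : 'Hom(hm, hp)) (phiS : 'Hom(hp, hm)) (x : h) : h :=
  (phi x.2, phiS x.1).

Definition dirac phi phiS : 'End(h) := linfun (dirac_fun phi phiS).

Lemma diracE phi phiS x : dirac phi phiS x = (phi x.2, phiS x.1).
Proof.
have lin : linear (dirac_fun phi phiS).
  by move=> k u v; rewrite /dirac_fun /= !linearP.
pose L := GRing.isLinear.Build _ _ _ _ _ lin.
pose F : {linear h -> h} := HB.pack (dirac_fun phi phiS) L.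
exact: (lfunE F x).
Qed.

Section Calculus.
Variable D : 'End(h).

Definition commD (a : AZ2) : 'End(h) := ((D \o rep a) - (rep a \o D))%VF.

Lemma commDM a b : commD (a * b) = ((rep a \o commD b) + (commD a \o rep b))%VF.
Proof.
rewrite /commD !repM comp_lfunDr comp_lfunDl comp_lfunNl comp_lfunNr.
by rewrite !comp_lfunA [RHS]addrC addrA subrK.
Qed.

Definition elementary_form (w : 'End(h)) : Prop :=
  exists a b : AZ2, w = (rep a \o commD b)%VF.

Record form1 : Type :=
  Form1 { form1_val :> 'End(h); _ : form1_val \in lspan elementary_form }.

HB.instance Definition _ := [isSub of form1 for form1_val].
HB.instance Definition _ := [Choice of form1 by <:].
HB.instance Definition _ := [SubChoice_isSubZmodule of form1 by <:].
HB.instance Definition _ := [SubZmodule_isSubLmodule of form1 by <:].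

Lemma lspan_form1_comp (L : 'End(h) -> 'End(h)) : linear L ->
  (forall w, elementary_form w -> L w \in lspan elementary_form) ->
  forall w : form1, L w \in lspan elementary_form.
Proof.
move=> linL Lel [w /= /asboolP [s [sel ->]]].
pose L' : {linear 'End(h) -> 'End(h)} :=
  HB.pack L (GRing.isLinear.Build _ _ _ _ _ linL).
rewrite -[L]/(L' : _ -> _) linear_sum big_seq; apply: rpred_sum => p /sel /Lel.
by rewrite linearZ; apply: rpredZ.
Qed.

Lemma lact1_subproof (a : AZ2) (w : form1) :
  (rep a \o w)%VF \in lspan elementary_form.
Proof.
apply: (lspan_form1_comp (L := comp_lfun (rep a))) => [k u v|v [b [c ->]]].
  by rewrite comp_lfunDr comp_lfunZr.
by apply: lspan_gen; exists (a * b), c; rewrite repM comp_lfunA.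
Qed.

Lemma ract1_subproof (w : form1) (a : AZ2) :
  (w \o rep a)%VF \in lspan elementary_form.
Proof.
apply: (lspan_form1_comp (L := fun v => (v \o rep a)%VF)) => [k u v|v [b [c ->]]].
  by rewrite comp_lfunDl comp_lfunZl.
have -> : ((rep b \o commD c) \o rep a)%VF =
           (rep b \o commD (c * a))%VF - (rep (b * c) \o commD a)%VF.
  by rewrite commDM repM comp_lfunDr !comp_lfunA [X in X - _]addrC addrK.
by apply: rpredB; apply: lspan_gen; do 2?eexists.
Qed.

Lemma elem1_subproof (a b : AZ2) : (rep a \o commD b)%VF \in lspan elementary_form.
Proof. by apply: lspan_gen; exists a, b. Qed.

Definition lact1 (a : AZ2) (w : form1) : form1 := Form1 (lact1_subproof a w).
Definition ract1 (w : form1) (a : AZ2) : form1 := Form1 (ract1_subproof w a).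
Definition elem1 (a b : AZ2) : form1 := Form1 (elem1_subproof a b).

Definition d1 (a : AZ2) : form1 := elem1 1 a.

Lemma d1E a : d1 a = commD a :> 'End(h).
Proof. by rewrite /= rep1 comp_lfun1l. Qed.

Definition eta : form1 := d1 (1, 0).

Definition T2 : Type := tensor ract1 lact1.
HB.instance Definition _ := GRing.Lmodule.on T2.

Definition tens1 (u v : form1) : T2 := tens ract1 lact1 u v.

Definition lact2 (a : AZ2) : T2 -> T2 := tensor_lift (fun u v => tens1 (lact1 a u) v).

Definition mult2 : T2 -> 'End(h) := tensor_lift (fun u v : form1 => (u \o v)%VF).

Lemma mult2_balanced :
  balanced_bilinear ract1 lact1 (fun u v : form1 => (u \o v)%VF).
Proof.
split=> [v k u u'|u k v v'|u a v] /=.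
- by rewrite comp_lfunDl comp_lfunZl.
- by rewrite comp_lfunDr comp_lfunZr.
- by rewrite comp_lfunA.
Qed.

Lemma mult2E u v : mult2 (tens1 u v) = (u \o v)%VF.
Proof. exact: (tensor_liftE mult2_balanced). Qed.

Lemma mult2_linear : linear mult2.
Proof. exact: (tensor_lift_linear mult2_balanced). Qed.

Lemma lact2_balanced a :
  balanced_bilinear ract1 lact1 (fun u v => tens1 (lact1 a u) v).
Proof.
split=> [v k u u'|u k v v'|u b v] /=.
- have -> : lact1 a (k *: u + u') = k *: lact1 a u + lact1 a u'.
    by apply: val_inj; rewrite /= comp_lfunDr comp_lfunZr.
  by rewrite /tens1 tensDl tensZl.
- by rewrite /tens1 tensDr tensZr.
- have -> : lact1 a (ract1 u b) = ract1 (lact1 a u) b.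
    by apply: val_inj; rewrite /= comp_lfunA.
  exact: tens_balanced.
Qed.

Lemma lact2E a u v : lact2 a (tens1 u v) = tens1 (lact1 a u) v.
Proof. exact: (tensor_liftE (lact2_balanced a)). Qed.

Lemma lact2_linear a : linear (lact2 a).
Proof. exact: (tensor_lift_linear (lact2_balanced a)). Qed.

Definition left_connection (nabla : {linear form1 -> T2}) : Prop :=
  forall a w, nabla (lact1 a w) = lact2 a (nabla w) + tens1 (d1 a) w.

Lemma form1_sum (w : form1) :
  exists s : seq (AZ2 * AZ2), w = \sum_(p <- s) elem1 p.1 p.2.
Proof.
case: w => w iw; have /asboolP [s [sel ws]] := iw.
have [t wt] : exists t : seq (AZ2 * AZ2), w = \sum_(p <- t) (rep p.1 \o commD p.2)%VF.
  rewrite {iw}ws; elim: s sel => [|p s IHs] sel.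
    by exists [::]; rewrite !big_nil.
  have [q|t et] := IHs; first by move=> qs; apply: sel; rewrite inE qs orbT.
  have [a [b pab]] := sel p (mem_head _ _).
  exists ((p.1 *: a, b) :: t); rewrite !big_cons et pab /=; congr (_ + _).
  have := rep_linear p.1 a 0; rewrite addr0 => ->.
  have -> : rep 0 = 0 by have := rep_linear (-1) 0 0; rewrite scaler0 addr0 scaleN1r addNr.
  by rewrite addr0 comp_lfunZl.
exists t; apply: val_inj; rewrite /= wt; elim: {wt} t => [|p t IHt].
  by rewrite !big_nil.
by rewrite !big_cons IHt.
Qed.

(* The differentials, computed on a chosen expression of w as a sum of forms
   a[D, b]; the choice is immaterial by d_sigma_sum and d_Psi_sum below.       *)
Definition form1_dec (w : form1) : seq (AZ2 * AZ2) := projT1 (cid (form1_sum w)).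

Definition d_sigma (w : form1) : 'End(h) :=
  \sum_(p <- form1_dec w) (commD p.1 \o commD p.2)%VF.

Definition d_Psi (w : form1) : T2 :=
  \sum_(p <- form1_dec w) tens1 (d1 p.1) (d1 p.2).

Definition torsion_sigma (nabla : form1 -> T2) (w : form1) : 'End(h) :=
  mult2 (nabla w) - d_sigma w.

Definition torsion_Psi (nabla : form1 -> T2) (w : form1) : T2 :=
  nabla w - d_Psi w.

Definition torsion_functional_sigma nabla (u v w : form1) : C :=
  lftrace (u \o v \o torsion_sigma nabla w)%VF.

Definition torsion_functional_Psi nabla (u v w : form1) : C :=
  lftrace (u \o v \o mult2 (torsion_Psi nabla w))%VF.

Definition spectral_torsion (u v w : form1) : C :=
  lftrace (u \o v \o w \o D)%VF.
End Calculus.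

Section WellDefined.
Variables (dotp : {dot hp for Num.conj}) (dotm : {dot hm for Num.conj}).
Variables (phi : 'Hom(hm, hp)) (phiS : 'Hom(hp, hm)).
Hypotheses (phi_neq0 : phi != 0) (adj : is_adjoint dotp dotm phi phiS).

Local Notation D := (dirac phi phiS).
Local Notation delta := (fun a : AZ2 => a.1 - a.2).

Lemma etaE x : eta D x = (- phi x.2, phiS x.1).
Proof.
rewrite d1E /commD add_lfunE opp_lfunE !comp_lfunE !(repE, diracE) /=.
by rewrite !scale1r !scale0r linear0; congr (_, _); rewrite ?sub0r ?subr0.
Qed.

Lemma commD_eta a : commD D a = delta a *: (eta D : 'End(h)).
Proof.
apply/lfunP => x; rewrite scale_lfunE etaE.
rewrite /commD add_lfunE opp_lfunE !comp_lfunE !(repE, diracE) /= !linearZ /=.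
congr (_, _) => /=; first by rewrite -scalerBl scalerN -scaleNr opprB.
by rewrite -scalerBl.
Qed.

Lemma phiS_neq0 : phiS != 0.
Proof.
apply: contra phi_neq0 => /eqP phiS0; apply/eqP/lfunP => y; rewrite zero_lfunE.
apply/eqP; apply: contraT => /(@neq0_dnorm_gt0 _ _ _ dotp).
by rewrite adj phiS0 zero_lfunE linear0 ltxx.
Qed.

Lemma rep_eta_inj a b :
  (rep a \o eta D = rep b \o eta D)%VF -> a = b.
Proof.
move=> ab.
have [y phiy] : exists y, phi y != 0.
  apply: contrapT => /forallNP p0; move/negP: phi_neq0; apply; apply/eqP/lfunP => y.
  by rewrite zero_lfunE; apply/eqP; have /negP := p0 y; rewrite negbK.
have [x phiSx] : exists x, phiS x != 0.
  apply: contrapT => /forallNP p0; move/negP: phiS_neq0; apply; apply/eqP/lfunP => x.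
  by rewrite zero_lfunE; apply/eqP; have /negP := p0 x; rewrite negbK.
have := congr1 (fun f : 'End(h) => f (x, y)) ab.
have rep_eta c : (rep c \o eta D)%VF (x, y) = rep c (eta D (x, y)).
  exact: comp_lfunE.
rewrite /= !rep_eta !etaE !repE /= => -[/eqP E1 /eqP E2].
rewrite -subr_eq0 -scalerBl scaler_eq0 oppr_eq0 (negPf phiy) orbF subr_eq0 in E1.
rewrite -subr_eq0 -scalerBl scaler_eq0 (negPf phiSx) orbF subr_eq0 in E2.
by case: a b E1 E2 {ab} => a1 a2 [b1 b2] /= /eqP -> /eqP ->.
Qed.

Let coef (s : seq (AZ2 * AZ2)) : AZ2 := \sum_(p <- s) delta p.2 *: p.1.

Let elem_sum s : \sum_(p <- s) elem1 D p.1 p.2 = lact1 (coef s) (eta D).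
Proof.
apply: val_inj; rewrite /coef /=; elim: s => [|p s IHs].
  rewrite !big_nil; have := rep_linear (-1) 0 0.
  by rewrite scaler0 addr0 scaleN1r addNr => ->; rewrite comp_lfun0l.
rewrite !big_cons /= IHs rep_linear comp_lfunDl; congr (_ + _).
by rewrite commD_eta -comp_lfunZl -comp_lfunZr.
Qed.

Let coef_dec (s : seq (AZ2 * AZ2)) :
  coef (form1_dec (\sum_(p <- s) elem1 D p.1 p.2)) = coef s.
Proof.
rewrite /form1_dec; case: cid => t /= e; apply: rep_eta_inj.
by move: e; rewrite !elem_sum => /(congr1 (@form1_val D)) /= ->.
Qed.

Let bil_sum (W : lmodType C) (w : W) s :
  \sum_(p <- s) (delta p.1 * delta p.2) *: w = delta (coef s) *: w.
Proof.
rewrite -scaler_suml /coef; congr (_ *: _); elim: s => [|p s IHs].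
  by rewrite !big_nil subrr.
rewrite !big_cons IHs /= opprD addrACA; congr (_ + _).
by rewrite [LHS]mulrC mulrBr.
Qed.

Lemma d_sigma_sum (s : seq (AZ2 * AZ2)) :
  d_sigma (\sum_(p <- s) elem1 D p.1 p.2) =
  \sum_(p <- s) (commD D p.1 \o commD D p.2)%VF.
Proof.
have sumE t : \sum_(p <- t) (commD D p.1 \o commD D p.2)%VF =
              delta (coef t) *: (eta D \o eta D)%VF.
  rewrite -bil_sum; apply: eq_bigr => p _.
  by rewrite !commD_eta -comp_lfunZl -comp_lfunZr scalerA.
by rewrite /d_sigma !sumE coef_dec.
Qed.

Lemma d1_eta a : d1 D a = delta a *: eta D.
Proof. by apply: val_inj; rewrite [LHS]d1E commD_eta. Qed.

Lemma d_Psi_sum (s : seq (AZ2 * AZ2)) :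
  d_Psi (\sum_(p <- s) elem1 D p.1 p.2) =
  \sum_(p <- s) tens1 (d1 D p.1) (d1 D p.2).
Proof.
have sumE t : \sum_(p <- t) tens1 (d1 D p.1) (d1 D p.2) =
              delta (coef t) *: tens1 (eta D) (eta D).
  rewrite -bil_sum; apply: eq_bigr => p _.
  by rewrite !d1_eta /tens1 tensZl tensZr scalerA.
by rewrite /d_Psi !sumE coef_dec.
Qed.
End WellDefined.
End TwoPointSpace.

(* Main.v *)
From HB Require Import structures.
Require Import Defs.
From mathcomp Require Import all_boot all_order all_algebra.
From mathcomp Require Import reals complex.

Import GRing.Theory.
Local Open Scope ring_scope.

(** The torsion functionals agree because the torsion operators themselves do:
    the torsion of nabla sends a one-form w to the operator w D.

    Since D is off-diagonal, [D, a] = (a_+ - a_-) eta, so every one-form is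
    a eta for some a in A, and a eta = a [D, e_+].  The Leibniz rule then gives
    nabla (a eta) = a c (eta (x) eta) + [D, a] (x) eta, and the second summand
    is exactly d (a [D, e_+]) = [D, a] (x) [D, e_+].  What remains of the
    torsion is a c (eta (x) eta), whose product is a (c eta eta)
    ([torsion_sigma_elem]).  The grading c = diag(1, -1) anticommutes with eta
    and eta c = D, so c eta eta = eta eta c = eta D ([grading_eta_eta]); hence
    the torsion operator of w = a eta is a eta D = w D
    ([torsion_sigma_dirac]).

    The two torsions are related by the multiplication map whatever the
    connection is, because m carries d_Psi to d_sigma ([mult2_torsion_Psi]). *)

Section Torsion.
Variables (C : numClosedFieldType) (hp hm : vectType C).

HB.instance Definition _ := GRing.isLinear.Build C (AZ2 C)
  'End((hp * hm)%type) _ (@rep C hp hm) (@rep_linear C hp hm).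

HB.instance Definition _ (D : 'End((hp * hm)%type)) := GRing.isLinear.Build C
  (T2 D) 'End((hp * hm)%type) _ (@mult2 C hp hm D) (@mult2_linear C hp hm D).

(** On elementary tensors m carries [D, a] (x) [D, b] to [D, a] [D, b], and both
    differentials are computed on the same decomposition of w. *)
Lemma mult2_torsion_Psi (D : 'End((hp * hm)%type))
    (nabla : form1 D -> T2 D) (w : form1 D) :
  mult2 (torsion_Psi nabla w) = torsion_sigma nabla w.
Proof.
rewrite linearB /torsion_sigma; congr (_ - _).
rewrite linear_sum; apply: eq_bigr => p _.
by rewrite /= mult2E !d1E.
Qed.

Variables (phi : 'Hom(hm, hp)) (phiS : 'Hom(hp, hm)).
Local Notation D := (dirac phi phiS).

(** Each a[D, b] is a scalar multiple of a eta. *)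
Lemma form1_eta (w : form1 D) : exists a : AZ2 C, w = lact1 a (eta D).
Proof.
have [s ->] := form1_sum w.
exists (\sum_(p <- s) (p.2.1 - p.2.2) *: p.1); apply: val_inj => /=.
rewrite linear_sum.
elim: s => [|p s IHs]; first by rewrite !big_nil comp_lfun0l.
rewrite !big_cons comp_lfunDl -IHs /=; congr (_ + _).
rewrite commD_eta linearZ /=.
by rewrite -comp_lfunZr -comp_lfunZl.
Qed.

(** The grading c = diag(1, -1) anticommutes with eta, hence commutes with
    eta eta; and eta c = D. *)
Lemma grading_eta_eta :
  (rep hp hm ((1, -1) : AZ2 C) \o (eta D \o eta D) = eta D \o D)%VF.
Proof.
(* Generalizing eta keeps its definition as a composite out of comp_lfunE. *)
have := etaE phi phiS; move: (form1_val (eta D)) => e eE.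
apply/lfunP => x; rewrite !comp_lfunE repE !eE diracE /=.
by rewrite scale1r scaleN1r linearN /= opprK.
Qed.

Variables (dotp : {dot hp for Num.conj}) (dotm : {dot hm for Num.conj}).
Hypotheses (phi_neq0 : phi != 0) (adj : is_adjoint dotp dotm phi phiS).

(** The inhomogeneous term of the Leibniz rule for a eta is d (a eta), so only
    a (nabla eta) contributes to the torsion. *)
Lemma torsion_sigma_elem (nabla : {linear form1 D -> T2 D}) (c a : AZ2 C) :
  left_connection nabla ->
  nabla (eta D) = lact2 c (tens1 (eta D) (eta D)) ->
  torsion_sigma nabla (lact1 a (eta D)) =
  (rep hp hm a \o (rep hp hm c \o (eta D \o eta D)))%VF.
Proof.
move=> leib nabla_eta.
have dE : d_sigma (lact1 a (eta D)) = (commD D a \o eta D)%VF.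
  have -> : lact1 a (eta D) = \sum_(p <- [:: (a, (1, 0) : AZ2 C)]) elem1 D p.1 p.2.
    by rewrite big_seq1; apply: val_inj; rewrite /= rep1 comp_lfun1l.
  by rewrite (d_sigma_sum phi_neq0 adj) big_seq1 /= rep1 comp_lfun1l.
rewrite /torsion_sigma dE leib nabla_eta !lact2E linearD.
by rewrite /= !mult2E d1E addrK /= !comp_lfunA.
Qed.

Lemma torsion_sigma_dirac (nabla : {linear form1 D -> T2 D}) (w : form1 D) :
  left_connection nabla ->
  nabla (eta D) = lact2 ((1, -1) : AZ2 C) (tens1 (eta D) (eta D)) ->
  torsion_sigma nabla w = (w \o D)%VF.
Proof.
move=> leib nabla_eta; have [a ->] := form1_eta w.
rewrite (torsion_sigma_elem nabla (1, -1) a leib nabla_eta) grading_eta_eta.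
by rewrite [LHS]comp_lfunA.
Qed.
End Torsion.

Theorem theorem3p2 (R : realType) (hp hm : vectType R[i])
  (dotp : {dot hp for Num.conj}) (dotm : {dot hm for Num.conj})
  (phi : 'Hom(hm, hp)) (phiS : 'Hom(hp, hm))
  (phi_neq0 : phi != 0) (phiS_adjoint : is_adjoint dotp dotm phi phiS)
  (nabla : {linear form1 (dirac phi phiS) -> T2 (dirac phi phiS)})
  (nabla_connection : left_connection nabla)
  (nabla_eta : nabla (eta (dirac phi phiS)) =
     lact2 ((1, -1) : AZ2 R[i])
       (tens1 (eta (dirac phi phiS)) (eta (dirac phi phiS)))) :
  forall u v w : form1 (dirac phi phiS),
    torsion_functional_sigma nabla u v w = torsion_functional_Psi nabla u v w /\
    torsion_functional_Psi nabla u v w = spectral_torsion u v w.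
Proof.
move=> u v w.
rewrite /torsion_functional_sigma /torsion_functional_Psi mult2_torsion_Psi.
split=> //; rewrite (torsion_sigma_dirac _ _ _ _ _ _ _ phi_neq0 phiS_adjoint) //.
by rewrite /spectral_torsion !comp_lfunA.
Qed.
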